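(* Let $n\ge 1$, let $C\subseteq \mathbb{Z}_4^n$ be a linear code over $\mathbb{Z}_4$ with $C^\perp\ne\{0\}$, and let $C'\subseteq\mathbb{Z}_2^{2n}$ be its Gray map image. Then $\mathrm{Str}(C')=w_L(C^\perp)-1$, where $w_L$ denotes the minimum Lee weight.
   Context: $\mathbb{Z}_m$ denotes the ring of integers modulo $m$. A linear code $C$ of length $n$ over $\mathbb{Z}_4$ is a $\mathbb{Z}_4$-submodule of $\mathbb{Z}_4^n$. Its dual is $C^\perp=\{(x_1,\ldots,x_n)\in \mathbb{Z}_4^n : x_1c_1+\cdots+x_nc_n=0 \text{ for all } (c_1,\ldots,c_n)\in C\}$. The Lee weights of the elements $0,1,2,3$ of $\mathbb{Z}_4$ are $0,1,2,1$ respectively (the number of steps from $0$ when $0,1,2,3$ are arranged around a circle), and the Lee weight $w_L(x)$ of $x\in\mathbb{Z}_4^n$ is the sum of the Lee weights of its coordinates. For a non-zero linear code $D$ over $\mathbb{Z}_4$, $w_L(D)$ denotes the minimum Lee weight among all non-zero codewords of $D$. The Gray map takes $\mathbb{Z}_4$ to $\mathbb{Z}_2^2$ by $0\mapsto 00$, $1\mapsto 01$, $2\mapsto 11$, $3\mapsto 10$, and is extended coordinatewise to a map $\mathbb{Z}_4^n\to\mathbb{Z}_2^{2n}$. The Gray map image $C'$ of $C$ is the set of images of the codewords of $C$ under this map; it is in general a non-linear binary code. An $N\times k$ array with entries from a finite alphabet $F$ is an orthogonal array of strength $t$ and index $\lambda$ (where $0\le t\le k$) if every $N\times t$ subarray (obtained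 by choosing $t$ distinct columns) contains each $t$-tuple over $F$ exactly $\lambda$ times as a row. A code $D\subseteq F^k$ (linear or not) is an orthogonal array of strength $t$ if the array whose rows are the codewords of $D$, each listed once, is an orthogonal array of strength $t$ for some index $\lambda$. $\mathrm{Str}(D)$ denotes the strength of $D$, i.e. the largest $t$ with $0\le t\le k$ such that $D$ is an orthogonal array of strength $t$. For $C'$ the alphabet is $F=\mathbb{Z}_2$ and $k=2n$. *)

(* Defs.v *)
From HB Require Import structures.
From mathcomp Require Import all_boot all_order all_algebra.

Set Implicit Arguments.
Unset Strict Implicit.
Unset Printing Implicit Defensive.

Import GRing.Theory.

Local Open Scope ring_scope.

Definition linear_code (n : nat) (C : {set 'rV['Z_4]_n}) : Prop :=
  GRing.submod_closed C.

Definition dual_code (n : nat) (C : {set 'rV['Z_4]_n}) : {set 'rV['Z_4]_n} :=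
  [set x : 'rV['Z_4]_n | [forall c in C, \sum_(i < n) x 0 i * c 0 i == 0]].

(* Distance from 0 when 0, 1, 2, 3 are arranged around a circle: the values
   at 0, 1, 2, 3 are 0, 1, 2, 1. *)
Definition lee_weight1 (a : 'Z_4) : nat := minn a (4 - a)%N.

Definition lee_weight (n : nat) (x : 'rV['Z_4]_n) : nat :=
  (\sum_(i < n) lee_weight1 (x 0%R i))%N.

(* Only meaningful when D has a non-zero element; the value is 0 otherwise. *)
Definition min_lee_weight (n : nat) (D : {set 'rV['Z_4]_n}) : nat :=
  if [pick x in D :\ 0] is Some x0
  then lee_weight [arg min_(x < x0 in D :\ 0) lee_weight x]
  else 0%N.

Lemma min_lee_weightP (n : nat) (D : {set 'rV['Z_4]_n}) (x : 'rV['Z_4]_n) :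
    x \in D -> x != 0 ->
  (exists2 y, y \in D :\ 0 & lee_weight y = min_lee_weight D) /\
  (forall y, y \in D :\ 0 -> (min_lee_weight D <= lee_weight y)%N).
Proof.
move=> xD x0; rewrite /min_lee_weight; case: pickP => [z zD | /(_ x)].
  by case: arg_minnP => // y yD ymin; split=> //; exists y.
by rewrite !inE x0 xD.
Qed.

Definition gray1 (a : 'Z_4) : 'rV['Z_2]_2 :=
  \row_(j < 2) nth 0 (nth [::] [:: [:: 0; 0]; [:: 0; 1]; [:: 1; 1]; [:: 1; 0]] a) j.

(* mxvec concatenates the rows of the n x 2 matrix of pairs of bits. *)
Definition gray (n : nat) (x : 'rV['Z_4]_n) : 'rV['Z_2]_(n * 2) :=
  mxvec (\matrix_(i < n) gray1 (x 0 i)).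

Definition gray_image (n : nat) (C : {set 'rV['Z_4]_n}) :
    {set 'rV['Z_2]_(n * 2)} :=
  [set gray x | x in C].

(* The columns of a subarray are chosen by an injective family f. *)
Definition orthogonal_array (F : finType) (N k : nat) (A : 'M[F]_(N, k))
    (t lambda : nat) : bool :=
  (t <= k)%N &&
  [forall f : {ffun 'I_t -> 'I_k}, injectiveb f ==>
     [forall v : 'rV[F]_t, #|[set r | row r (colsub f A) == v]| == lambda]].

Definition code_array (F : finType) (k : nat) (D : {set 'rV[F]_k}) :
    'M[F]_(#|D|, k) :=
  \matrix_(r < #|D|) enum_val r.

(* The index counts rows, so it can be sought among 0, ..., #|D|; see
   code_oaP. *)
Definition code_oa (F : finType) (k : nat) (D : {set 'rV[F]_k}) (t : nat) :
    bool :=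
  [exists lambda : 'I_#|D|.+1, orthogonal_array (code_array D) t lambda].

Lemma code_oaP (F : finType) (a : F) (k : nat) (D : {set 'rV[F]_k}) (t : nat) :
  reflect (exists lambda, orthogonal_array (code_array D) t lambda)
          (code_oa D t).
Proof.
apply: (iffP existsP) => [[l Dl] | [l Dl]].
  by exists l.
have lD : (l < #|D|.+1)%N.
  have /andP[tk /forallP/(_ (finfun (widen_ord tk)))/implyP Dl'] := Dl.
  have /Dl'/forallP/(_ (const_mx a))/eqP <- : injectiveb (finfun (widen_ord tk)).
    by apply/injectiveP=> i j; rewrite !ffunE => /(congr1 val) /= /val_inj.
  by rewrite ltnS -[X in (_ <= X)%N]card_ord max_card.
by exists (Ordinal lD).
Qed.

Definition strength (F : finType) (k : nat) (D : {set 'rV[F]_k}) : nat :=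
  (\max_(t < k.+1 | code_oa D t) t)%N.

Lemma strengthP (F : finType) (k : nat) (D : {set 'rV[F]_k}) :
  code_oa D (strength D) /\ (forall t, code_oa D t -> (t <= strength D)%N).
Proof.
have D0 : code_oa D (@ord0 k).
  apply/existsP; exists ord_max; rewrite /orthogonal_array /=.
  apply/forallP=> f; apply/implyP=> _; apply/forallP=> v.
  rewrite (_ : [set r | _] = setT) ?cardsT ?card_ord //.
  by apply/setP=> r; rewrite !inE; apply/eqP/rowP; case.
split=> [|t Dt].
  by rewrite /strength (bigmax_eq_arg ord0) //; case: arg_maxnP.
have /existsP[l /andP[tk _]] := Dt.
exact: (leq_bigmax_cond (Ordinal (tk : (t < k.+1)%N)) Dt).
Qed.

(* Main.v *)
(* A binary code is an orthogonal array of strength t iff its sums of Walsh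
   characters y |-> (-1)^(sum_(k in S) y_k) vanish for all S with
   0 < |S| <= t.  On one coordinate a in Z_4, the Walsh characters
   of the pair of Gray bits indexed by a set of bits of size w and the
   characters a |-> i^(u a) whose index u has Lee weight w are linear combinations
   of each other.  Tensoring over the coordinates, the Walsh sums of C' over
   the sets S of size w all vanish iff the sums of i^(x . c) over c in C vanish
   for all x of Lee weight w; such a sum is |C| if x is in the dual of C, and
   0 otherwise. *)
Require Import Defs.
From mathcomp Require Import all_boot all_order all_algebra all_field.
From mathcomp Require Import ring.

Set Implicit Arguments.
Unset Strict Implicit.
Unset Printing Implicit Defensive.

Import Order.TTheory GRing.Theory Num.Theory.

Local Open Scope ring_scope.

(** * Character sums over finite groups and Walsh characters *)

(** Translation by [a0] permutes [A] and multiplies the sum by [h a0], a factor other than 1; in an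
    integral domain the sum must be 0. *)
Lemma char_sum_eq0 (V : finZmodType) (R : idomainType) (A : {set V})
    (h : V -> R) (a0 : V) :
    (forall a b, h (a + b) = h a * h b) -> zmod_closed A -> a0 \in A ->
    h a0 != 1 ->
  \sum_(a in A) h a = 0.
Proof.
move=> hD [A0 AB] Aa0 h1.
have AN a : a \in A -> - a \in A by move=> Aa; rewrite -sub0r AB.
have AD a b : a \in A -> b \in A -> a + b \in A.
  by move=> Aa Ab; rewrite -[b]opprK AB ?AN.
have eS : \sum_(a in A) h a = h a0 * \sum_(a in A) h a.
  rewrite [LHS](reindex_inj (addrI a0)) mulr_sumr /=; apply: eq_big => [a|a _].
    apply/idP/idP => [Aa|]; last exact: AD.
    by rewrite -[a](addKr a0) AD ?AN.
  exact: hD.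
apply/eqP; move/eqP: eS; rewrite -subr_eq0 -{1}[\sum_(a in A) h a]mul1r -mulrBl.
by rewrite mulf_eq0 subr_eq0 eq_sym (negPf h1).
Qed.

(** Addition in ['I_p.+2] is modulo [p.+2], and so are exponents of [z]. Used with [z = -1] on Z_2
    and [z = 'i] on Z_4. *)
Lemma root_expD (R : nzRingType) (p : nat) (z : R) (a b : 'I_p.+2) :
  z ^+ p.+2 = 1 -> z ^+ (a + b)%R = z ^+ a * z ^+ b.
Proof. by move=> zp; rewrite -exprD -(expr_mod (a + b) zp). Qed.

Definition sgn2 (a : 'Z_2) : algC := (-1) ^+ a.

Definition walsh (k : nat) (S : {set 'I_k}) (y : 'rV['Z_2]_k) : algC :=
  \prod_(i in S) sgn2 (y 0 i).

Lemma sgn2D a b : sgn2 (a + b) = sgn2 a * sgn2 b.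
Proof. by apply: (@root_expD _ 0); rewrite sqrrN expr1n. Qed.

Lemma walshD k (S : {set 'I_k}) x y : walsh S (x + y) = walsh S x * walsh S y.
Proof.
by rewrite -big_split; apply: eq_bigr => i _; rewrite !mxE sgn2D.
Qed.

Lemma walsh_delta k (S : {set 'I_k}) i : i \in S -> walsh S (delta_mx 0 i) = -1.
Proof.
move=> iS; rewrite /walsh (bigD1 i) //= big1 ?mxE ?eqxx ?mulr1 //.
by move=> j /andP[_ /negPf ji]; rewrite mxE ji.
Qed.

Lemma walsh_sumT k (S : {set 'I_k}) : S != set0 -> \sum_y walsh S y = 0.
Proof.
case/set0Pn=> i iS; rewrite -(eq_bigl _ _ (@in_setT _)).
apply: (@char_sum_eq0 _ _ _ _ (delta_mx 0 i)) => //; first exact: walshD.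
  by split=> [|u v _ _]; rewrite inE.
  by rewrite inE.
by rewrite walsh_delta // eq_sym -addr_eq0 -(natrD _ 1 1) pnatr_eq0.
Qed.

(** * Orthogonal arrays and vanishing Walsh sums *)

Lemma card_rows_code_array (F : finType) k (D : {set 'rV[F]_k}) t
    (f : 'I_t -> 'I_k) (v : 'rV[F]_t) :
  #|[set r | row r (colsub f (code_array D)) == v]| =
  #|[set y in D | colsub f y == v]|.
Proof.
rewrite -(card_imset _ (@enum_val_inj _ (mem D))); apply: eq_card => y.
have rowE r : row r (colsub f (code_array D)) = colsub f (enum_val r).
  by apply/rowP=> j; rewrite !mxE.
rewrite inE; apply/imsetP/andP => [[r] | [yD yv]].
  by rewrite inE rowE => rv ->; split=> //; apply: enum_valP.
by exists (enum_rank_in yD y); rewrite ?inE ?rowE enum_rankK_in.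
Qed.

Lemma walsh_colsub k t (f : 'I_t -> 'I_k) (J : {set 'I_t}) y :
  injective f -> walsh J (colsub f y) = walsh (f @: J) y.
Proof.
move=> f_inj; rewrite /walsh big_imset /=; last by move=> i j _ _; apply: f_inj.
by apply: eq_bigr => j _; rewrite mxE.
Qed.

(** Strength [t] speaks of exactly [t] columns, so a smaller [S] has to be padded: list [S] first,
    then its complement, and keep the first [t] entries. *)
Lemma exists_cover k t (S : {set 'I_k}) : (#|S| <= t <= k)%N ->
  exists2 f : {ffun 'I_t -> 'I_k}, injective f & S \subset codom f.
Proof.
case/andP=> St tk; pose s := enum S ++ enum (~: S).
have sz : size s = k by rewrite size_cat -!cardE cardsC card_ord.
have us : uniq s.
  rewrite cat_uniq !enum_uniq /= andbT; apply/hasPn=> i.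
  by rewrite !mem_enum inE.
pose f := [ffun j : 'I_t => tnth (in_tuple s) (cast_ord (esym sz) (widen_ord tk j))].
exists f => [i j|].
  rewrite !ffunE => /(tuple_uniqP (in_tuple s) us) /(congr1 val) /=.
  exact: val_inj.
apply/subsetP=> x xS; have xs : (index x s < t)%N.
  by rewrite index_cat mem_enum xS (leq_trans _ St) // cardE index_mem mem_enum.
apply/codomP; exists (Ordinal xs); rewrite ffunE (tnth_nth x) /= nth_index //.
by rewrite mem_cat mem_enum xS.
Qed.

(** Group the codewords by their restriction to [t] columns covering [S]: each [v] occurs [l] times,
    which leaves [l] times the full sum of a nontrivial Walsh character. *)
Lemma code_oa_walsh k (D : {set 'rV['Z_2]_k}) t (S : {set 'I_k}) :
  code_oa D t -> (0 < #|S| <= t)%N -> \sum_(y in D) walsh S y = 0.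
Proof.
case/existsP=> l /andP[tk /forallP oa] /andP[S0 St].
have [|f f_inj Sf] := @exists_cover k t S; first by rewrite St.
have /injectiveP/(implyP (oa f))/forallP {}oa := f_inj.
pose J := f @^-1: S; have SJ : S = f @: J.
  apply/setP=> x; apply/idP/imsetP => [xS|[j]]; last by rewrite inE => ? ->.
  by have /codomP[j xj] := subsetP Sf x xS; exists j; rewrite // inE -xj.
rewrite (partition_big (colsub f) predT) //=.
under eq_bigr => v _.
  rewrite (eq_bigr (fun=> walsh J v)); last first.
    by move=> y /andP[_ /eqP <-]; rewrite SJ walsh_colsub.
  rewrite sumr_const (_ : #|_| = l); last first.
    move/eqP: (oa v); rewrite card_rows_code_array => <-.
    by apply: eq_card => y; rewrite !inE.
  over.
rewrite sumrMnl walsh_sumT ?mul0rn //.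
by apply: contraTneq S0; rewrite SJ => ->; rewrite imset0 cards0.
Qed.

(** Fourier inversion on Z_2^t: the sum expands a product whose factor at [j] is 2 if [u] and [v]
    agree there and 0 otherwise. *)
Lemma indicator_walsh t (u v : 'rV['Z_2]_t) :
  (2 ^ t * (u == v))%:R = \sum_(J : {set 'I_t}) walsh J v * walsh J u.
Proof.
have -> : \sum_(J : {set 'I_t}) walsh J v * walsh J u =
          \prod_(j < t) (sgn2 ((u + v) 0 j) + 1).
  by rewrite bigA_distr; apply: eq_bigr => J _; rewrite mulrC -walshD -big_mkcond.
have sgnE a b : sgn2 (a + b) + 1 = (2 * (a == b))%:R.
  by case: a b => [[|[|?]] ?] [[|[|?]] ?] //=;
     rewrite /sgn2 /= ?expr1 ?expr0 ?addNr -?natrD.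
under eq_bigr do rewrite mxE sgnE natrM.
rewrite big_split /= prodr_const card_ord -natrX natrM; congr (_ * _).
have [->|uv] := eqVneq u v; first by rewrite big1 // => j _; rewrite eqxx.
have /existsP[j /negPf uvj] : [exists j, u 0 j != v 0 j].
  apply: contraNT uv => /existsPn uv; apply/eqP/rowP=> j.
  by apply/eqP; rewrite -[_ == _]negbK uv.
by rewrite (bigD1 j) //= uvj mul0r.
Qed.

Lemma walsh_code_oa k (D : {set 'rV['Z_2]_k}) t : (t <= k)%N ->
    (forall S : {set 'I_k}, (0 < #|S| <= t)%N -> \sum_(y in D) walsh S y = 0) ->
  code_oa D t.
Proof.
(* The candidate index; the division is exact by the [suff] below. *)
move=> tk D0; apply/(code_oaP (0 : 'Z_2)); exists (#|D| %/ 2 ^ t)%N.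
rewrite /orthogonal_array tk; apply/forallP=> f; apply/implyP=> /injectiveP f_inj.
apply/forallP=> v; rewrite card_rows_code_array.
suff -> : #|D| = (2 ^ t * #|[set y in D | colsub f y == v]|)%N.
  by rewrite mulKn ?expn_gt0.
apply/eqP; rewrite -(eqr_nat algC) -[X in (_ * X)%N]sum1_card big_distrr /=.
rewrite natr_sum; under eq_bigl do rewrite inE.
rewrite big_mkcondr /=; under [X in _ == X]eq_bigr => y _.
  rewrite (_ : (if _ then _ else _) = (2 ^ t * (colsub f y == v))%:R); last first.
    by case: eqP => _; rewrite ?muln1 ?muln0.
  rewrite indicator_walsh; over.
(* The empty [J] contributes [#|D|]; any other [J] gives the Walsh sum of [f @: J], which [D0]
   kills. *)
rewrite exchange_big (bigD1 set0) //= [X in _ + X]big1 => [|J J0].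
  rewrite addr0 -sumr_const; apply/eqP/eq_bigr => y _.
  by rewrite /walsh !big_set0 mulr1.
under eq_bigr => y _ do rewrite walsh_colsub //.
rewrite -mulr_sumr D0 ?mulr0 // card_imset // card_gt0 J0.
by rewrite -[leqRHS]card_ord max_card.
Qed.

(** * Passing between the Walsh characters of Gray bits and the characters of Z_4 *)

(** Expand the product of sums over all choices [u]. A nonzero coefficient forces equal weights at
    each coordinate, hence equal total weights, where [phi0] applies. Used in both directions
    between [gray_walsh] and [char4]. *)
Lemma prod_sum_transfer (R : comNzRingType) (I A B U : finType) (X : Type)
    (C : seq X) (c : X -> I -> A) (g : B -> A -> R) (phi : U -> A -> R)
    (K : B -> U -> R) (wB : B -> nat) (wU : U -> nat) (b : I -> B) :
    (forall b a, g b a = \sum_u K b u * phi u a) ->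
    (forall b u, K b u != 0 -> wU u = wB b) ->
    (forall u : {ffun I -> U}, (\sum_i wU (u i) = \sum_i wB (b i))%N ->
       \sum_(x <- C) \prod_i phi (u i) (c x i) = 0) ->
  \sum_(x <- C) \prod_i g (b i) (c x i) = 0.
Proof.
move=> gE Kw phi0.
under eq_bigr => x _.
  under eq_bigr => i _ do rewrite gE.
  rewrite bigA_distr_bigA /=; under eq_bigr do rewrite big_split /=; over.
rewrite exchange_big big1 //= => u _; rewrite -mulr_sumr.
have [/forallP Ku|/forallPn[i]] := boolP [forall i, K (b i) (u i) != 0].
  by rewrite phi0 ?mulr0 //; apply: eq_bigr => i _; apply: Kw.
by rewrite negbK (bigD1 i) //= => /eqP->; rewrite !mul0r.
Qed.

Definition char4 (u a : 'Z_4) : algC := 'i ^+ (u * a)%R.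

Definition gray_walsh (b : bool * bool) (a : 'Z_4) : algC :=
  (if b.1 then sgn2 (gray1 a 0 0) else 1) *
  (if b.2 then sgn2 (gray1 a 0 1) else 1).

Definition gray_weight (b : bool * bool) : nat := (b.1 + b.2)%N.

(** Fourier coefficients on Z_4. The sign of the first Gray bit is ((1-i) i^a + (1+i) i^(-a))/2,
    that of the second is its conjugate in the coefficients, and the product of the two signs is
    (-1)^a = i^(2a). *)
Definition gray_walsh_coef (b : bool * bool) (u : 'Z_4) : algC :=
  match b, val u with
  | (false, false), 0%N | (true, true), 2%N => 1
  | (true, false), 1%N | (false, true), 3%N => (1 - 'i) / 2
  | (true, false), 3%N | (false, true), 1%N => (1 + 'i) / 2
  | _, _ => 0
  end.

(** The inverse matrix: [gray_walsh_coef] is unitary and its weight 1 block is symmetric, so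
    conjugating the entries suffices. *)
Definition char4_coef (u : 'Z_4) (b : bool * bool) : algC :=
  match b, val u with
  | (false, false), 0%N | (true, true), 2%N => 1
  | (true, false), 1%N | (false, true), 3%N => (1 + 'i) / 2
  | (true, false), 3%N | (false, true), 1%N => (1 - 'i) / 2
  | _, _ => 0
  end.

Lemma gray_walsh_coef_weight b u :
  gray_walsh_coef b u != 0 -> lee_weight1 u = gray_weight b.
Proof.
by case: b => [[] []]; case: u => [[|[|[|[|?]]]] ?] //=;
   rewrite /gray_walsh_coef /= ?eqxx.
Qed.

Lemma char4_coef_weight u b :
  char4_coef u b != 0 -> gray_weight b = lee_weight1 u.
Proof.
by case: b => [[] []]; case: u => [[|[|[|[|?]]]] ?] //=;
   rewrite /char4_coef /= ?eqxx.
Qed.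

Lemma char4E (u a : 'Z_4) :
  char4 u a = nth 0 [:: 1; 'i; -1; - 'i] (u * a %% 4).
Proof.
rewrite /char4 /=; have := ltn_pmod (u * a) (isT : (0 < 4)%N).
case: (_ %% _)%N => [|[|[|[|//]]]] _ //=; rewrite ?expr0 ?expr1 ?sqrCi //.
by rewrite exprS sqrCi mulrN1.
Qed.

Lemma gray_walshE b (a : 'Z_4) :
  gray_walsh b a = (if b.1 then nth 0 [:: 1; 1; -1; -1] a else 1) *
                   (if b.2 then nth 0 [:: 1; -1; -1; 1] a else 1).
Proof.
rewrite /gray_walsh /sgn2 !mxE /=.
by case: a => [[|[|[|[|?]]]] ?].
Qed.

Lemma gray_walsh_char4 b a :
  gray_walsh b a = \sum_u gray_walsh_coef b u * char4 u a.
Proof.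
rewrite !big_ord_recl big_ord0 !char4E gray_walshE /gray_walsh_coef.
have ii : 'i * 'i = -1 :> algC by rewrite -expr2 sqrCi.
case: b => [[] []]; case: a => [[|[|[|[|?]]]] ?] //=;
  field: ii; by rewrite ?pnatr_eq0.
Qed.

Lemma char4_gray_walsh u a :
  char4 u a = \sum_b char4_coef u b * gray_walsh b a.
Proof.
rewrite (eq_bigr (fun b => char4_coef u (b.1, b.2) * gray_walsh (b.1, b.2) a));
  last by case.
rewrite -(pair_bigA _ (fun x y => char4_coef u (x, y) * gray_walsh (x, y) a)) /=.
rewrite !big_bool !char4E !gray_walshE /char4_coef.
have ii : 'i * 'i = -1 :> algC by rewrite -expr2 sqrCi.
case: u => [[|[|[|[|?]]]] ?]; case: a => [[|[|[|[|?]]]] ?] //=;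
  field: ii; by rewrite ?pnatr_eq0.
Qed.

(** The product is i^(x . c), a character of [C] that is trivial exactly when [x] is in the dual,
    since i has order 4. *)
Lemma char4_sum n (C : {set 'rV['Z_4]_n}) (x : 'rV['Z_4]_n) :
    linear_code C ->
  \sum_(c in C) \prod_i char4 (x 0 i) (c 0 i) =
    if x \in dual_code C then #|C|%:R else 0.
Proof.
move=> linC; pose e (c : 'rV['Z_4]_n) : algC := 'i ^+ (\sum_i x 0 i * c 0 i)%R.
have i4 : 'i ^+ 4 = 1 :> algC by rewrite (exprM _ 2 2) sqrCi sqrrN expr1n.
have iD (a b : 'Z_4) : 'i ^+ (a + b)%R = 'i ^+ a * 'i ^+ b :> algC.
  by apply: (@root_expD _ 2).
have eE (c : 'rV['Z_4]_n) : \prod_i char4 (x 0 i) (c 0 i) = e c.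
  by rewrite /e (big_morph (fun a : 'Z_4 => 'i ^+ a) iD (erefl : 'i ^+ (0 : 'Z_4)%R = 1)).
under eq_bigr do rewrite eE.
case: ifPn; rewrite inE; first move=> /forall_inP xC.
  by rewrite -sumr_const; apply: eq_bigr => c /xC/eqP xc; rewrite /e xc.
case/forall_inPn=> c0 Cc0 xc0; apply: (@char_sum_eq0 _ _ C e c0) => //.
- move=> a b; rewrite /e -iD -big_split; congr (_ ^+ _).
  by congr (nat_of_ord _); apply: eq_bigr => i _; rewrite mxE mulrDr.
- exact: GRing.submod_closedB.
have N1 : -1 != 1 :> algC by rewrite eq_sym -addr_eq0 -(natrD _ 1 1) pnatr_eq0.
(* For exponents 1 and 3, squaring a value 1 would give -1 = 1; exponent 2 gives -1 directly. *)
rewrite /e; case: (\sum_i _) xc0 => [[|[|[|[|?]]]] ?] //= _.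
- by apply: contra_neq N1 => i1; rewrite -sqrCi (i1 : 'i = 1) expr1n.
- by rewrite sqrCi.
apply: contra_neq N1 => i3; have: ('i ^+ 3) ^+ 2 = 1 :> algC by rewrite i3 expr1n.
by rewrite -exprM (exprM _ 2 3) sqrCi exprS sqrrN expr1n mulr1.
Qed.

(** * Walsh sums of the Gray image *)

Lemma big_mxvec_index (R : Type) (idx : R) (op : Monoid.com_law idx) m n
    (P : pred 'I_(m * n)) (F : 'I_(m * n) -> R) :
  \big[op/idx]_(k | P k) F k =
  \big[op/idx]_i \big[op/idx]_(j | P (mxvec_index i j)) F (mxvec_index i j).
Proof.
rewrite pair_big_dep (reindex (uncurry (@mxvec_index m n))) /=; last first.
  by have [g gK Kg] := curry_mxvec_bij m n; exists g => [p|k] _; rewrite ?gK ?Kg ?inE.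
by apply: eq_big => [[i j]|[i j] _].
Qed.

(** Recording a set of bit positions coordinate by coordinate lets its Walsh character factor over
    the coordinates of Z_4^n. *)
Definition gray_index n (S : {set 'I_(n * 2)}) (i : 'I_n) : bool * bool :=
  (mxvec_index i 0 \in S, mxvec_index i 1 \in S).

Lemma walsh_gray n (S : {set 'I_(n * 2)}) (c : 'rV['Z_4]_n) :
  walsh S (gray c) = \prod_i gray_walsh (gray_index S i) (c 0 i).
Proof.
rewrite /walsh big_mxvec_index; apply: eq_bigr => i _ /=.
have lift1 : lift ord0 ord0 = 1 :> 'I_2 by apply: val_inj.
by rewrite big_mkcond big_ord_recl big_ord1 /= lift1 !mxvecE !mxE /gray_walsh !mxE.
Qed.

Lemma card_gray_index n (S : {set 'I_(n * 2)}) :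
  #|S| = (\sum_i gray_weight (gray_index S i))%N.
Proof.
rewrite -sum1_card big_mxvec_index; apply: eq_bigr => i _ /=.
have lift1 : lift ord0 ord0 = 1 :> 'I_2 by apply: val_inj.
by rewrite big_mkcond big_ord_recl big_ord1 lift1 /gray_weight /=; do 2!case: (_ \in _).
Qed.

Lemma gray_index_surj n (b : 'I_n -> bool * bool) :
  {S : {set 'I_(n * 2)} | forall i, gray_index S i = b i}.
Proof.
exists [set k | mxvec (\matrix_(i < n, j < 2) if j == 0 then (b i).1 else (b i).2) 0 k].
by move=> i; rewrite /gray_index !inE !mxvecE !mxE; case: (b i).
Qed.

Lemma gray_inj n : injective (@gray n).
Proof.
move=> x y /(can_inj mxvecK)/matrixP xy; apply/rowP=> i.
have := xy i 0; have := xy i 1; rewrite !mxE /=.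
by case: (x 0 i) => [[|[|[|[|?]]]] ?]; case: (y 0 i) => [[|[|[|[|?]]]] ?] //= _ _;
   apply: val_inj.
Qed.

Lemma sum_walsh_gray n (C : {set 'rV['Z_4]_n}) (S : {set 'I_(n * 2)}) :
  \sum_(y in gray_image C) walsh S y =
  \sum_(c in C) \prod_i gray_walsh (gray_index S i) (c 0 i).
Proof.
rewrite big_imset /=; last by move=> x y _ _; apply: gray_inj.
by apply: eq_bigr => c _; apply: walsh_gray.
Qed.

(** The Walsh sum combines character sums of words of Lee weight [#|S|]; none of these is in the
    dual, so all of them vanish. *)
Lemma gray_sum_eq0 n (C : {set 'rV['Z_4]_n}) (S : {set 'I_(n * 2)}) :
    linear_code C ->
    (forall x, x \in dual_code C -> lee_weight x != #|S|) ->
  \sum_(y in gray_image C) walsh S y = 0.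
Proof.
move=> linC dualC; rewrite sum_walsh_gray -big_enum.
apply: (prod_sum_transfer gray_walsh_char4 gray_walsh_coef_weight) => u uS.
pose x := \row_i u i.
have wx : lee_weight x = #|S|.
  by rewrite card_gray_index -uS; apply: eq_bigr => i _; rewrite mxE.
have xC : x \notin dual_code C by apply: contraL (eqxx #|S|) => /dualC; rewrite wx.
have := char4_sum x linC; rewrite big_enum (negPf xC) => x0; rewrite -[RHS]x0.
by apply: eq_bigr => c _; apply: eq_bigr => i _; rewrite mxE.
Qed.

(** If all Walsh sums of this size vanished, the reverse transfer would make the character sum of
    [x] zero, but it equals [#|C|]. *)
Lemma dual_gray_sum_neq0 n (C : {set 'rV['Z_4]_n}) (x : 'rV['Z_4]_n) :
    linear_code C -> x \in dual_code C ->
  exists2 S : {set 'I_(n * 2)}, #|S| = lee_weight x &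
    \sum_(y in gray_image C) walsh S y != 0.
Proof.
move=> linC xC.
suff /existsP[S /andP[/eqP wS sS]] : [exists S : {set 'I_(n * 2)},
  (#|S| == lee_weight x) && (\sum_(y in gray_image C) walsh S y != 0)] by exists S.
have: \sum_(c in C) \prod_i char4 (x 0 i) (c 0 i) != 0.
  have [C0 _] := linC; rewrite char4_sum // xC pnatr_eq0 -lt0n.
  by apply/card_gt0P; exists 0.
apply: contraNT => /existsPn sum0; apply/eqP; rewrite -big_enum.
apply: (prod_sum_transfer char4_gray_walsh char4_coef_weight) => b bx.
have [S Sb] := gray_index_surj b.
have wS : #|S| = lee_weight x.
  by rewrite card_gray_index -[RHS]bx; apply: eq_bigr => i _; rewrite Sb.
have := sum0 S; rewrite wS eqxx negbK sum_walsh_gray -big_enum => /eqP S0; rewrite -[RHS]S0.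
by apply: eq_bigr => c _; apply: eq_bigr => i _; rewrite Sb.
Qed.

(** * Lee weight bounds and the strength of the Gray image *)

Lemma lee_weight_eq0 n (x : 'rV['Z_4]_n) : (lee_weight x == 0%N) = (x == 0).
Proof.
rewrite /lee_weight sum_nat_eq0; apply/forallP/eqP => [x0|-> i].
  apply/rowP=> i; rewrite mxE; have := x0 i.
  by case: (x 0 i) => [[|[|[|[|?]]]] ?] //= _; apply: val_inj.
by rewrite mxE.
Qed.

Lemma lee_weight_le n (x : 'rV['Z_4]_n) : (lee_weight x <= n * 2)%N.
Proof.
have -> : (n * 2 = \sum_(i < n) 2)%N by rewrite sum_nat_const card_ord.
by apply: leq_sum => i _; case: (x 0 i) => [[|[|[|[|?]]]] ?].
Qed.

Theorem theorem4p1 (n : nat) (C : {set 'rV['Z_4]_n}) (hn : (1 <= n)%N)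
    (hC : linear_code C) (hdual : dual_code C != [set 0]) :
  strength (gray_image C) = (min_lee_weight (dual_code C) - 1)%N.
Proof.
have C0 : 0 \in dual_code C.
  by rewrite inE; apply/forall_inP=> c _; rewrite big1 // => i _; rewrite mxE mul0r.
have /subsetPn[x xC] : ~~ (dual_code C \subset [set 0]).
  by apply: contra hdual => sub; rewrite eqEsubset sub sub1set.
rewrite inE => /(min_lee_weightP xC)[[y]]; rewrite in_setD1 => /andP[y0 yC] wy wmin.
(* Positivity makes the truncated subtraction of 1 exact. *)
have w0 : (0 < lee_weight y)%N by rewrite lt0n lee_weight_eq0.
have [oaS maxS] := strengthP (gray_image C); apply/eqP; rewrite eqn_leq -wy.
apply/andP; split.
  (* Strength at least the weight of [y] would annihilate the nonzero Walsh sum that [y]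
     provides. *)
  rewrite -ltnS subn1 prednK // ltnNge; apply/negP=> yS.
  have [S SE /eqP[]] := dual_gray_sum_neq0 hC yC.
  by rewrite (code_oa_walsh oaS) // SE w0.
apply/maxS/walsh_code_oa => [|S Sy].
  by rewrite (leq_trans (leq_subr _ _)) ?lee_weight_le.
apply: gray_sum_eq0 => // z zC; apply: contraTneq Sy => <-.
(* A dual word has weight 0 or at least that of [y], so its weight is never the size of a nonempty
   [S] in range. *)
rewrite negb_and -leqNgt leqn0 lee_weight_eq0 -ltnNge subn1 prednK // wy.
by have [//|z0] := eqVneq z 0; rewrite wmin // in_setD1 z0.
Qed.
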